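(* There exists a family of cardinality $c$ of sets in $\mathcal{U}$ which are pairwise metrically similar (and hence homeomorphic) but pairwise not order-isomorphic. Likewise, there exists a family of cardinality $c$ of sets in $\mathcal{A}$ which are pairwise metrically similar (and hence homeomorphic) but pairwise not order-isomorphic.
   Context: $c$ denotes the cardinality of $\mathbb{R}$. $\mathcal{U}$ is the family of all open subsets of the Euclidean real line $\mathbb{R}$. $\mathcal{A}$ is the family of all closed subsets of $\mathbb{R}$ which are unions of mutually disjoint nondegenerate closed intervals; equivalently, closed subsets of $\mathbb{R}$ no connected component of which is a singleton. Two sets $X, Y \subset \mathbb{R}$ (with the Euclidean metric) are metrically similar if there is a bijection $f$ from $X$ onto $Y$ such that both $f$ and $f^{-1}$ are uniformly continuous. Two sets $X, Y \subset \mathbb{R}$ are order-isomorphic if there exists a strictly increasing function from $X$ onto $Y$. *)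

(* Defs.v *)
From mathcomp Require Import all_boot all_order all_algebra.
From mathcomp Require Import all_classical all_reals all_analysis.
Import numFieldNormedType.Exports.

Set Implicit Arguments.
Unset Strict Implicit.
Unset Printing Implicit Defensive.

Import Order.TTheory GRing.Theory Num.Theory.
Local Open Scope classical_set_scope.
Local Open Scope ring_scope.

Definition open_sets (R : realType) : set (set R) := [set X | open X].

(* Intervals are order-convex sets, so the closed ones include the closed
   half-lines and the whole line; "nondegenerate" excludes both singletons and
   the empty set. *)
Definition nondegenerate_closed_interval (R : realType) (I : set R) : Prop :=
  [/\ is_interval I, closed I & exists x y : R, [/\ I x, I y & x < y]].

(* The family G need not be countable, and its union need not be closed:
   closedness of X is a separate requirement. *)
Definition closed_interval_unions (R : realType) : set (set R) :=
  [set X | closed X /\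
    exists G : set (set R),
      [/\ forall I, G I -> nondegenerate_closed_interval I,
          trivIset G id
        & X = \bigcup_(I in G) I]].

(* In the next two definitions X and Y are coerced to the sigma-types
   [set_type X] and [set_type Y], which carry the topology and the uniformity
   induced by R. *)
Definition metrically_similar (R : realType) (X Y : set R) : Prop :=
  exists (f : X -> Y) (g : Y -> X),
    [/\ cancel f g, cancel g f, unif_continuous f & unif_continuous g].

Definition homeomorphic (R : realType) (X Y : set R) : Prop :=
  exists (f : X -> Y) (g : Y -> X),
    [/\ cancel f g, cancel g f, continuous f & continuous g].

Definition order_isomorphic (R : realType) (X Y : set R) : Prop :=
  exists f : R -> R,
    {in X &, {homo f : x y / x < y}} /\ f @` X = Y.

(* Main.v *)
(** Take an asymmetric bounded block B of intervals: a core [-1, 0] and the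
    bricks [4^-k, 2 4^-k], which accumulate at the core from the right. For a
    0-1 sequence s let X_s be the union over n of B translated by 8n, reflected
    when s n is false. Reflecting blocks one by one is isometric at distances
    below 1, so all the X_s are metrically similar. An order isomorphism maps
    components to components; the components lacking an immediate successor
    (resp. having something to their left but no immediate predecessor) are the
    cores of the blocks with s n true (resp. false), and they form a sequence of
    order type omega, so s can be read off the order type of X_s. Every real r
    gives a sequence s, namely the characteristic function of its rational
    Dedekind cut. Open intervals yield open sets; closed ones yield closed sets,
    as the only accumulation point of B not in a brick is 0, in the core. *)
Require Import Defs.
From mathcomp Require Import all_boot all_order all_algebra.
From mathcomp Require Import all_classical all_reals all_analysis.
From mathcomp Require Import lra.
Import numFieldNormedType.Exports.
Import Order.TTheory GRing.Theory Num.Theory.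

Set Implicit Arguments.
Unset Strict Implicit.
Unset Printing Implicit Defensive.

Local Open Scope classical_set_scope.
Local Open Scope ring_scope.
Local Open Scope card_scope.

(** * Linked points and order isomorphisms *)

(* For points of X: to lie in the same connected component. *)
Definition linked (R : realType) (X : set R) (x y : R) : Prop :=
  forall z, (x <= z <= y) || (y <= z <= x) -> X z.

Lemma linked_sym (R : realType) (X : set R) x y : linked X x y -> linked X y x.
Proof. by move=> h z; rewrite orbC; exact: h. Qed.

Lemma linked_trans (R : realType) (X : set R) y x z :
  linked X x y -> linked X y z -> linked X x z.
Proof.
move=> hxy hyz w hw.
have [h|h] : (x <= w <= y) || (y <= w <= x) \/ (y <= w <= z) || (z <= w <= y).
- lra.
- exact: hxy.
- exact: hyz.
Qed.

Lemma linkedl (R : realType) (X : set R) x y : linked X x y -> X x.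
Proof. by move=> h; apply: h; lra. Qed.

Lemma linked_le (R : realType) (X : set R) x y : x <= y ->
  (forall z, x <= z <= y -> X z) -> linked X x y.
Proof. by move=> xy h z hz; apply: h; lra. Qed.

(** Both maps are total on [R] but constrained only on [X] and [Y]; carrying the inverse makes the
    notion symmetric, so every transport result also applies backwards. *)
Record oiso (R : realType) (f g : R -> R) (X Y : set R) : Prop := Oiso {
  oiso_fun : forall x, X x -> Y (f x);
  oiso_inv : forall y, Y y -> X (g y);
  oisoK : forall x, X x -> g (f x) = x;
  oisoVK : forall y, Y y -> f (g y) = y;
  oiso_lt : forall x y, X x -> X y -> x < y -> f x < f y }.

Lemma oiso_sym (R : realType) (f g : R -> R) (X Y : set R) :
  oiso f g X Y -> oiso g f Y X.
Proof.
move=> [fX gY fK gK fM]; split=> // x y Yx Yy xy.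
have := fM _ _ (gY _ Yy) (gY _ Yx); rewrite !gK// => h.
case: (ltgtP (g x) (g y)) => // [/h|e]; first lra.
by move: xy; rewrite -(gK _ Yx) e gK// ltxx.
Qed.

Lemma order_isomorphic_oiso (R : realType) (X Y : set R) :
  order_isomorphic X Y -> exists f g, oiso f g X Y.
Proof.
move=> [f [fM <-]].
have fm x y : X x -> X y -> x < y -> f x < f y.
  by move=> Xx Xy; apply: fM; exact: mem_set.
(* Choice needs a total relation, so points outside the image get the default 0. *)
have gP y : exists x, (f @` X) y -> X x /\ f x = y.
  case: (pselect ((f @` X) y)) => [[x Xx <-]|n]; first by exists x.
  by exists 0 => /n.
have [g /= hg] := choice gP.
exists f, g; split=> //.
- by move=> y yX; have [] := hg _ yX.
- move=> x Xx; have [Xg e] : X (g (f x)) /\ f (g (f x)) = f x.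
    by apply: hg; exact: imageP.
  case: (ltgtP (g (f x)) x) => // h.
  + by have := fm _ _ Xg Xx h; lra.
  + by have := fm _ _ Xx Xg h; lra.
- by move=> y yX; have [] := hg _ yX.
Qed.

(** * Order isomorphisms preserve components *)

(* Open sets satisfy this because neither extremum exists, closed sets because
   both do; intervals having exactly one, a gap cannot map into an interval. *)
Definition cut_balanced (R : realType) (X : set R) : Prop := forall z, ~ X z ->
  (exists a, X a /\ a < z) -> (exists b, X b /\ z < b) ->
  (exists m, [/\ X m, m < z & forall v, X v -> v < z -> v <= m]) <->
  (exists m, [/\ X m, z < m & forall v, X v -> z < v -> m <= v]).

(** Suppose the image of [[x, y]] jumped over a point [z] outside [Y]. The supremum [p] of the
    points sent below [z] is itself in [X], so [f p] is an extremum of one side of the cut at [z].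
    Balance supplies an extremum [m] on the other side, and points between [p] and [g m] then have
    images that beat [m]. *)
Lemma oiso_linked_lt (R : realType) (f g : R -> R) (X Y : set R) x y :
  cut_balanced Y -> oiso f g X Y -> x < y -> linked X x y -> linked Y (f x) (f y).
Proof.
move=> cY [fX gY fK gK fM] xy lxy.
have Xi w : x <= w <= y -> X w by move=> h; apply: lxy; rewrite h.
have Xx : X x by apply: Xi; lra.
have Xy : X y by apply: Xi; lra.
have fle u v : X u -> X v -> f u < f v -> u < v.
  by move=> Xu Xv; case: (ltgtP u v) => // [/(fM _ _ Xv Xu)|->]; lra.
have fxy := fM _ _ Xx Xy xy.
apply: linked_le; first lra.
move=> z hz; apply: contrapT => nYz.
have zx : f x != z by apply/eqP => e; apply: nYz; rewrite -e; exact: fX.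
have zy : f y != z by apply/eqP => e; apply: nYz; rewrite -e; exact: fX.
have {hz zx zy} [fxz zfy] : f x < z /\ z < f y by split; lra.
pose L := [set w | x <= w <= y /\ f w < z].
have L0 : L x by split; lra.
have Lub : ubound L y by move=> w [] h _; lra.
have hs : has_sup L by split; [exists x | exists y].
pose p := sup L.
have xp : x <= p by exact: sup_upper_bound.
have py : p <= y by apply: ge_sup => //; exists x.
have Lp w : L w -> w <= p by exact: sup_upper_bound.
have pL q : ubound L q -> p <= q by move=> h; apply: ge_sup => //; exists x.
have Xp : X p by apply: Xi; lra.
have npz : f p != z by apply/eqP => e; apply: nYz; rewrite -e; exact: fX.
have [c1 c2] : (exists m, [/\ Y m, m < z & forall v, Y v -> v < z -> v <= m]) <->
  (exists m, [/\ Y m, z < m & forall v, Y v -> z < v -> m <= v]).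
  by apply: cY => //; [exists (f x)|exists (f y)]; split => //; exact: fX.
have [pz|pz] : f p < z \/ z < f p by lra.
- have py' : p < y by apply: fle => //; lra.
  have [|m [Ym zm mP]] := c1.
    exists (f p); split => //; first exact: fX.
    move=> v Yv vz; rewrite leNgt; apply/negP => pv.
    have Xg := gY _ Yv.
    have : p < g v by apply: fle; rewrite ?gK.
    have : g v < y by apply: fle; rewrite ?gK//; lra.
    move=> h1 h2; suff : g v <= p by lra.
    by apply: Lp; split; rewrite ?gK//; lra.
  have Xm := gY _ Ym.
  have pm : p < g m by apply: fle; rewrite ?gK//; lra.
  (* The point [g m] may lie beyond [y], where [X] can have gaps, so [w] is kept inside [[x, y]]. As
     [w] exceeds [p], its image is above [z], yet it is below [m]. *)
  have [w [pw wm wy]] : exists w, [/\ p < w, w < g m & w <= y].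
    have [h|h] : g m <= y \/ y < g m by lra.
    - by exists ((p + g m) / 2); split; lra.
    - by exists ((p + y) / 2); split; lra.
  have Xw : X w by apply: Xi; lra.
  have : f w < m by rewrite -(gK _ Ym); exact: fM.
  have zw : z < f w.
    have e : f w != z by apply/eqP => e; apply: nYz; rewrite -e; exact: fX.
    rewrite lt_neqAle eq_sym e leNgt; apply/negP => wz.
    have wp : w <= p by apply: Lp; split; lra.
    lra.
  by have := mP _ (fX _ Xw) zw; lra.
- have px' : x < p by apply: fle => //; lra.
  have [|m [Ym zm mP]] := c2.
    exists (f p); split => //; first exact: fX.
    move=> v Yv vz; rewrite leNgt; apply/negP => pv.
    have Xg := gY _ Yv.
    have : g v < p by apply: fle; rewrite ?gK.
    suff : p <= g v by lra.
    apply: pL => w [hw wz]; apply/ltW/fle; rewrite ?gK//; last lra.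
    exact: Xi.
  have Xm := gY _ Ym.
  have pm : g m < p by apply: fle; rewrite ?gK//; lra.
  have [w [pw wm wy]] : exists w, [/\ w < p, g m < w & x <= w].
    have [h|h] : g m <= x \/ x < g m by lra.
    - by exists ((p + x) / 2); split; lra.
    - by exists ((p + g m) / 2); split; lra.
  have Xw : X w by apply: Xi; lra.
  have : m < f w by rewrite -(gK _ Ym); exact: fM.
  have zw : f w < z.
    have e : f w != z by apply/eqP => e; apply: nYz; rewrite -e; exact: fX.
    rewrite lt_neqAle e leNgt; apply/negP => wz; suff : p <= w by lra.
    apply: pL => u [hu uz]; apply/ltW/fle => //; last lra.
    exact: Xi.
  by have := mP _ (fX _ Xw) zw; lra.
Qed.

Lemma oiso_linked (R : realType) (f g : R -> R) (X Y : set R) x y :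
  cut_balanced Y -> oiso f g X Y -> linked X x y -> linked Y (f x) (f y).
Proof.
move=> cY o l; case: (ltgtP x y) => [h|h|e].
- exact: (oiso_linked_lt cY o).
- by apply: linked_sym; apply: (oiso_linked_lt cY o) => //; exact: linked_sym.
- subst y; move=> z hz; have -> : z = f x by lra.
  by apply: (oiso_fun o); exact: (linkedl l).
Qed.

Lemma open_dist (R : realType) (X : set R) m : open X -> X m ->
  exists2 d, 0 < d & forall y, `|m - y| < d -> X y.
Proof.
move=> oX Xm; have /nbhs_ballP[d /= d0 dX] : nbhs m X by exact: open_nbhs_nbhs.
by exists d => // y h; exact: dX.
Qed.

Lemma open_cut_balanced (R : realType) (X : set R) : open X -> cut_balanced X.
Proof.
move=> oX z nXz _ _; split=> -[m [Xm mz mP]]; exfalso;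
  have [d d0 dX] := open_dist oX Xm.
(* The minimum keeps [y] both in the ball around [m] and below [z], so [y] refutes the maximality of
   [m]. *)
- pose y := Num.min (m + d / 2) ((m + z) / 2).
  have hy : m < y /\ y < z /\ y < m + d.
    by rewrite /y; case: (leP (m + d / 2)) => ?; split; lra.
  have Xy : X y by apply: dX; rewrite ltr_norml; lra.
  by have := mP _ Xy; lra.
- pose y := Num.max (m - d / 2) ((m + z) / 2).
  have hy : y < m /\ z < y /\ m - d < y.
    by rewrite /y; case: (leP (m - d / 2)) => ?; split; lra.
  have Xy : X y by apply: dX; rewrite ltr_norml; lra.
  by have := mP _ Xy; lra.
Qed.

Lemma closed_cut_balanced (R : realType) (X : set R) : closed X -> cut_balanced X.
Proof.
move=> cX z nXz [a [Xa az]] [b [Xb bz]].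
have oX m : ~ X m -> exists2 d, 0 < d & forall y, `|m - y| < d -> ~ X y.
  by move=> nX; apply: (@open_dist _ (~` X)) => //; exact: closed_openC.
have nz m : X m -> m != z by move=> Xm; apply/eqP => e; apply: nXz; rewrite -e.
split=> _.
- pose E := [set v | X v /\ z < v].
  have hE : has_inf E by split; [exists b | exists z => v [] _ /ltW].
  have zm : z <= inf E by apply: lb_le_inf; [exists b | move=> v [] _ /ltW].
  have mE v : X v -> z < v -> inf E <= v.
    by move=> Xv zv; apply: ge_inf => //; exact: hE.2.
  have Xm : X (inf E).
    apply: contrapT => /oX[r r0 rX]; have [e [Xe ze] er] := inf_adherent r0 hE.
    by have := mE _ Xe ze; move=> ?; apply: (rX _ _ Xe); rewrite ltr_norml; lra.
  by exists (inf E); split => //; have := nz _ Xm; lra.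
- pose E := [set v | X v /\ v < z].
  have hE : has_sup E by split; [exists a | exists z => v [] _ /ltW].
  have zm : sup E <= z by apply: ge_sup; [exists a | move=> v [] _ /ltW].
  have mE v : X v -> v < z -> v <= sup E.
    by move=> Xv zv; exact: sup_upper_bound.
  have Xm : X (sup E).
    apply: contrapT => /oX[r r0 rX]; have [e [Xe ze] er] := sup_adherent r0 hE.
    by have := mE _ Xe ze; move=> ?; apply: (rX _ _ Xe); rewrite ltr_norml; lra.
  by exists (sup E); split => //; have := nz _ Xm; lra.
Qed.

(** * Components without an immediate neighbour *)

Definition before (R : realType) (e : bool) (x y : R) : bool :=
  if e then x < y else y < x.

(* The component of x is not the last one in the direction e (true is
   increasing), and has no immediate neighbour there. *)
Definition one_sided_limit (R : realType) (e : bool) (X : set R) (x : R) : Prop :=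
  [/\ X x,
      exists y, [/\ X y, before e x y & ~ linked X x y]
    & forall y, X y -> before e x y -> ~ linked X x y ->
        exists w, [/\ X w, before e x w, before e w y, ~ linked X x w
                    & ~ linked X w y]].

Lemma oiso_linkedE (R : realType) (f g : R -> R) (X Y : set R) x y :
  cut_balanced X -> cut_balanced Y -> oiso f g X Y -> X x -> X y ->
  linked Y (f x) (f y) <-> linked X x y.
Proof.
move=> cX cY o Xx Xy; split; last exact: oiso_linked cY o.
by move/(oiso_linked cX (oiso_sym o)); rewrite !(oisoK o).
Qed.

Lemma oiso_before (R : realType) (f g : R -> R) (X Y : set R) e x y :
  oiso f g X Y -> X x -> X y -> before e x y -> before e (f x) (f y).
Proof. by case: e => o Xx Xy; exact: (oiso_lt o). Qed.

Lemma oiso_one_sided_limit (R : realType) (f g : R -> R) (X Y : set R) e x :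
  cut_balanced X -> cut_balanced Y -> oiso f g X Y ->
  one_sided_limit e X x -> one_sided_limit e Y (f x).
Proof.
move=> cX cY o [Xx [y [Xy xy nxy]] xP]; have o' := oiso_sym o.
have lE := oiso_linkedE cX cY o.
split; first exact: (oiso_fun o).
- exists (f y); split; first exact: (oiso_fun o).
  + exact: oiso_before o _ _ _.
  + by rewrite lE.
- move=> z Yz xz nxz; have Xz := oiso_inv o Yz.
  have ez := oisoVK o Yz; rewrite -ez in nxz.
  have [||w [Xw xw wz nxw nwz]] := xP _ Xz.
  + by rewrite -(oisoK o Xx); apply: oiso_before o' _ _ _ => //; exact: (oiso_fun o).
  + by rewrite -lE.
  + exists (f w); split; first exact: (oiso_fun o).
    * exact: oiso_before o _ _ _.
    * by rewrite -ez; exact: oiso_before o _ _ _.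
    * by rewrite lE.
    * by rewrite -ez lE.
Qed.

(** * The block of intervals *)

Definition lec (R : realType) (c : bool) (x y : R) : bool :=
  if c then x <= y else x < y.

(** With ratio 1/4 the top of brick [k.+1] is half the bottom of brick [k], so consecutive bricks
    are separated by a gap of length [scale R k / 2]. *)
Definition scale (R : realType) (k : nat) : R := 4^-1 ^+ k.

(* c = true gives closed intervals, c = false open ones. *)
Definition brick (R : realType) (c : bool) (k : nat) : set R :=
  [set x | lec c (scale R k) x && lec c x (2 * scale R k)].

Arguments brick R c k _ : clear implicits.

Definition core (R : realType) (c : bool) : set R :=
  [set x | lec c (-1) x && lec c x 0].

Arguments core R c _ : clear implicits.

Definition block (R : realType) (c : bool) : set R :=
  core R c `|` \bigcup_k brick R c k.

Arguments block R c _ : clear implicits.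

Lemma lecW (R : realType) c (x y : R) : lec c x y -> x <= y.
Proof. by case: c => //= /ltW. Qed.

Lemma ltW_lec (R : realType) c (x y : R) : x < y -> lec c x y.
Proof. by case: c => //= /ltW. Qed.

Lemma scale_gt0 (R : realType) k : 0 < scale R k.
Proof. by rewrite exprn_gt0// invr_gt0. Qed.

Lemma scaleS (R : realType) k : scale R k.+1 = scale R k / 4.
Proof. by rewrite /scale exprSr. Qed.

Lemma scale_le (R : realType) k l : (k <= l)%N -> scale R l <= scale R k.
Proof.
move=> kl; apply: ler_wiXn2l => //; lra.
Qed.

Lemma scale_lt (R : realType) k l : (k < l)%N -> scale R l <= scale R k / 4.
Proof. by move=> kl; rewrite -scaleS; exact: scale_le. Qed.

Lemma core_le (R : realType) c (x : R) : core R c x -> -1 <= x <= 0.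
Proof. by move=> /andP[/lecW -> /lecW ->]. Qed.

Lemma brick_le (R : realType) c k (x : R) :
  brick R c k x -> scale R k <= x <= 2 * scale R k.
Proof. by move=> /andP[/lecW -> /lecW ->]. Qed.

Lemma brick_mid (R : realType) c k : brick R c k (3 / 2 * scale R k).
Proof. by have := scale_gt0 R k => h; apply/andP; split; apply: ltW_lec; lra. Qed.

Lemma core_mid (R : realType) c : core R c (- (1 / 2)).
Proof. by apply/andP; split; apply: ltW_lec; lra. Qed.

Lemma block_bounds (R : realType) c (x : R) : block R c x -> -1 <= x <= 2.
Proof.
case=> [/core_le|[k _ /brick_le]]; first lra.
have := scale_le R (leq0n k); have := scale_gt0 R k; rewrite /scale expr0; lra.
Qed.

Lemma block_le0 (R : realType) c (x : R) : block R c x -> x <= 0 -> core R c x.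
Proof. by case=> // -[k _ /brick_le]; have := scale_gt0 R k; lra. Qed.

Lemma block_gt0 (R : realType) c (x : R) : block R c x -> 0 < x ->
  exists k, brick R c k x.
Proof. by case=> [/core_le|[k _ h] _]; [lra|exists k]. Qed.

Lemma brick_block (R : realType) c k (x : R) : brick R c k x -> block R c x.
Proof. by move=> h; right; exists k. Qed.

Lemma core_linked (R : realType) c (x y : R) :
  core R c x -> core R c y -> linked (block R c) x y.
Proof.
by case: c => /andP[/= ? ?] /andP[/= ? ?] z hz; left; apply/andP => /=; lra.
Qed.

Lemma brick_linked (R : realType) c k (x y : R) :
  brick R c k x -> brick R c k y -> linked (block R c) x y.
Proof.
by case: c => /andP[/= ? ?] /andP[/= ? ?] z hz; apply: (@brick_block _ _ k);
  apply/andP => /=; lra.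
Qed.

Lemma block_gap (R : realType) c k (x : R) :
  scale R k / 2 < x < scale R k -> ~ block R c x.
Proof.
move=> hx h; have := scale_gt0 R k => a0.
have /(block_gt0 h)[l /brick_le] : 0 < x by lra.
case: (ltnP k l) => [/(scale_lt R)|/(scale_le R)]; lra.
Qed.

(** The separating point [3 / 4 * scale R k] is the midpoint of the gap just below brick [k]. *)
Lemma block_unlinked (R : realType) c k (x y : R) :
  x < 3 / 4 * scale R k -> 3 / 4 * scale R k < y ->
  ~ linked (block R c) x y /\ ~ linked (block R c) y x.
Proof.
have a0 := scale_gt0 R k; move=> h1 h2.
have gap : ~ block R c (3 / 4 * scale R k) by apply: (@block_gap R c k); lra.
by split=> h; apply: gap; apply: h; lra.
Qed.

(** If [y] is in brick [k], then brick [k.+1] lies strictly between the core and [y]. *)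
Lemma block_core_limit (R : realType) c (x y : R) :
  x <= 0 -> block R c x -> block R c y -> ~ linked (block R c) x y ->
  exists w, [/\ block R c w, x < w, w < y, ~ linked (block R c) x w
              & ~ linked (block R c) w y].
Proof.
move=> x0 Bx By nxy; have Cx := block_le0 Bx x0.
have [y0|y0] := leP y 0.
  by case: nxy; apply: core_linked => //; exact: block_le0.
have [k /brick_le hk] := block_gt0 By y0.
have a0 := scale_gt0 R k; have aS := scaleS R k.
exists (3 / 2 * scale R k.+1); split; try lra.
- exact: brick_block (brick_mid _ _ _).
- by apply: (block_unlinked c (k := k.+1) _ _).1; lra.
- by apply: (block_unlinked c (k := k) _ _).1; lra.
Qed.

Definition last_in (R : realType) (e : bool) (B : set R) (x : R) : Prop :=
  B x /\ forall w, B w -> before e x w -> linked B x w.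

Lemma block_last (R : realType) c e : exists x, last_in e (block R c) x.
Proof.
case: e.
- exists (3 / 2 * scale R 0); split; first exact: brick_block (brick_mid _ _ _).
  have a1 : scale R 0 = 1 by rewrite /scale expr0.
  move=> w Bw /= hw; have [|k hk] := block_gt0 Bw; first lra.
  case: k hk => [|k] hk; first exact: brick_linked (brick_mid _ _ _) hk.
  by have := brick_le hk; have := scale_lt R (ltn0Sn k); lra.
- exists (- (1 / 2)); split; first by left; exact: core_mid.
  move=> w Bw /= hw; apply: core_linked; first exact: core_mid.
  by apply: block_le0 => //; lra.
Qed.

(** The core seen in the increasing direction is the only place where a further component exists but
    no immediate one. Brick [k] has brick [k.+1] below it and, for positive [k], brick [k.-1] above
    it; brick 0 is the last one upwards and the core the last one downwards. *)
Lemma block_next (R : realType) c (e : bool) (x : R) : block R c x ->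
  [\/ e /\ x <= 0, last_in e (block R c) x |
      exists y, [/\ block R c y, before e x y, ~ linked (block R c) x y &
        forall w, block R c w -> before e x w -> before e w y ->
          linked (block R c) x w \/ linked (block R c) w y]].
Proof.
move=> Bx; case: (leP x 0) => x0.
  case: e; first by constructor 1.
  constructor 2; split=> // w Bw /= wx.
  by apply: core_linked; apply: block_le0 => //; lra.
have [k hk] := block_gt0 Bx x0; have hk' := brick_le hk.
have a0 := scale_gt0 R k.
case: e; last first.
  have aS := scaleS R k.
  constructor 3; exists (3 / 2 * scale R k.+1); split => /=; try lra.
  - exact: brick_block (brick_mid _ _ _).
  - by apply: (block_unlinked c (k := k) _ _).2; lra.
  - move=> w Bw wx yw; have [|l hl] := block_gt0 Bw; first lra.
    have hl' := brick_le hl; have al := scale_gt0 R l.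
    case: (ltngtP k l) => kl.
    + have [le|le] : l = k.+1 \/ (k.+1 < l)%N.
        by move: kl; rewrite leq_eqVlt => /orP[/eqP <-|]; [left|right].
      * by right; subst l; exact: brick_linked hl (brick_mid _ _ _).
      * have := scale_lt R le; lra.
    + have := scale_lt R kl; lra.
    + by left; subst l; exact: brick_linked hk hl.
case: k hk hk' a0 => [|k] hk hk' a0.
  constructor 2; split => // w Bw /= xw; have [|l hl] := block_gt0 Bw; first lra.
  case: l hl => [|l] hl; first exact: brick_linked hk hl.
  by have := brick_le hl; have := scale_lt R (ltn0Sn l); lra.
have aS := scaleS R k.
constructor 3; exists (3 / 2 * scale R k); split => /=; try lra.
- exact: brick_block (brick_mid _ _ _).
- by apply: (block_unlinked c (k := k) _ _).1; lra.
- move=> w Bw wx yw; have [|l hl] := block_gt0 Bw; first lra.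
  have hl' := brick_le hl; have al := scale_gt0 R l.
  case: (ltngtP k l) => kl.
  + have [le|le] : l = k.+1 \/ (k.+1 < l)%N.
      by move: kl; rewrite leq_eqVlt => /orP[/eqP <-|]; [left|right].
    * by left; subst l; exact: brick_linked hk hl.
    * have := scale_lt R le; lra.
  + have := scale_lt R kl; lra.
  + by right; subst l; exact: brick_linked hl (brick_mid _ _ _).
Qed.

(** * Blocks placed along the line *)

Definition chart (R : realType) (s : nat -> bool) (n : nat) (x : R) : R :=
  if s n then x - 8 * n%:R else 8 * n%:R - x.

Definition place (R : realType) (s : nat -> bool) (n : nat) (u : R) : R :=
  if s n then 8 * n%:R + u else 8 * n%:R - u.

(** A block lies in [[-1, 2]], so either orientation of copy [n] stays within 2 of its centre
    [8 * n%:R]; the spacing 8 leaves gaps of length at least 4 between copies. *)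
Definition spread (R : realType) (c : bool) (s : nat -> bool) : set R :=
  [set x | exists n, block R c (chart s n x)].
Arguments spread R c s _ : clear implicits.

Lemma placeK (R : realType) s n : cancel (@place R s n) (chart s n).
Proof. by move=> u; rewrite /place /chart; case: (s n); lra. Qed.

Lemma chartK (R : realType) s n : cancel (@chart R s n) (place s n).
Proof. by move=> u; rewrite /place /chart; case: (s n); lra. Qed.

Lemma natr_lt_succ (R : realType) (n m : nat) : (n < m)%N -> n%:R + 1 <= m%:R :> R.
Proof. by move=> nm; rewrite natr1 ler_nat. Qed.

Lemma chart_bounds (R : realType) c s n (x : R) :
  block R c (chart s n x) -> 8 * n%:R - 2 <= x <= 8 * n%:R + 2.
Proof. by move/block_bounds; rewrite /chart; case: (s n); lra. Qed.

Lemma chart_uniq (R : realType) c s n m (x : R) :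
  8 * n%:R - 4 <= x <= 8 * n%:R + 4 -> block R c (chart s m x) -> m = n.
Proof.
move=> h /chart_bounds hm.
by case: (ltngtP m n) => // /(natr_lt_succ R) ?; exfalso; lra.
Qed.

Lemma spread_chart (R : realType) c s n (x : R) :
  8 * n%:R - 4 <= x <= 8 * n%:R + 4 -> spread R c s x -> block R c (chart s n x).
Proof. by move=> h [m hm]; rewrite -(chart_uniq h hm). Qed.

Lemma chart_between (R : realType) s n (x y z : R) :
  ((chart s n x <= chart s n z <= chart s n y) ||
   (chart s n y <= chart s n z <= chart s n x)) =
  ((x <= z <= y) || (y <= z <= x)).
Proof. by rewrite /chart; case: (s n); lra. Qed.

(** Whatever lies between two points of copy [n] is still within 2 of its centre, where no other
    copy reaches, so linkedness can be tested in the chart. *)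
Lemma linked_chart (R : realType) c s n (x y : R) :
  block R c (chart s n x) -> block R c (chart s n y) ->
  linked (block R c) (chart s n x) (chart s n y) <-> linked (spread R c s) x y.
Proof.
move=> Bx By; split=> h z hz.
- by exists n; apply: h; rewrite chart_between.
- rewrite -(placeK s n z); apply: spread_chart.
    by have := chart_bounds Bx; have := chart_bounds By; move: hz;
       rewrite -{1 2 3 4}(placeK s n z) chart_between; lra.
  by apply: h; rewrite -(chart_between s n) placeK.
Qed.

Lemma linked_same_chart (R : realType) c s n m (x y : R) :
  block R c (chart s n x) -> block R c (chart s m y) ->
  linked (spread R c s) x y -> n = m.
Proof.
move=> Bx By h; have hx := chart_bounds Bx; have hy := chart_bounds By.
case: (ltngtP n m) => // nm; have nm' := natr_lt_succ R nm; exfalso.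
(* The point halfway between two consecutive centres belongs to no copy. *)
- have [k hk] : spread R c s (8 * n%:R + 4) by apply: h; lra.
  have e : k = n by apply: chart_uniq hk; lra.
  by subst k; have := chart_bounds hk; lra.
- have [k hk] : spread R c s (8 * m%:R + 4) by apply: h; lra.
  have e : k = m by apply: chart_uniq hk; lra.
  by subst k; have := chart_bounds hk; lra.
Qed.

Lemma before_chart (R : realType) s n e (x y : R) :
  before e x y = before (s n == e) (chart s n x) (chart s n y).
Proof. by rewrite /before /chart; case: (s n); case: e => /=; lra. Qed.

(** * Recovering the sequence from the order type *)

Definition core_point (R : realType) (s : nat -> bool) (n : nat) : R :=
  place s n (- (1 / 2)).

Lemma block_core_point (R : realType) c s n :
  block R c (chart s n (core_point R s n)).
Proof. by rewrite placeK; left; exact: core_mid. Qed.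

Lemma one_sided_limit_core_point (R : realType) c s n :
  one_sided_limit (s n) (spread R c s) (core_point R s n).
Proof.
have Bc := block_core_point R c s n.
(* Brick 0 of copy [n] is the intermediate component whenever [y] lies in another copy; for [y] in
   the same copy a smaller brick is used. *)
pose w := place s n (3 / 2 * scale R 0 : R).
have Bw : block R c (chart s n w).
  by rewrite placeK; exact: brick_block (brick_mid _ _ _).
have cw : before (s n) (core_point R s n) w.
  rewrite (before_chart s n) eqxx !placeK /=; have := scale_gt0 R 0; lra.
have ncw : ~ linked (spread R c s) (core_point R s n) w.
  rewrite -(linked_chart Bc Bw) !placeK; have := scale_gt0 R 0 => a0.
  by apply: (block_unlinked c (k := 0%N) _ _).1; lra.
split; first by exists n.
- by exists w; split => //; exists n.
move=> y [m By] cy ncy; case: (eqVneq m n) => [e|mn].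
- subst m; rewrite (before_chart s n) eqxx /= in cy.
  rewrite -(linked_chart Bc By) in ncy.
  have c0 : chart s n (core_point R s n) <= 0 by rewrite placeK; lra.
  have [v [Bv cv vy ncv nvy]] := block_core_limit c0 Bc By ncy.
  rewrite -(placeK s n v) in Bv.
  exists (place s n v); split; first by exists n.
  + by rewrite (before_chart s n) placeK eqxx.
  + by rewrite (before_chart s n) placeK eqxx.
  + by rewrite -(linked_chart Bc Bv) (placeK s n v).
  + by rewrite -(linked_chart Bv By) (placeK s n v).
- exists w; split => //; first by exists n.
  + have hw := chart_bounds Bw; have hy := chart_bounds By.
    have hc := chart_bounds Bc; move: cy; rewrite /before.
    case: (ltngtP m n) => nm; last by rewrite nm eqxx in mn.
    * by have := natr_lt_succ R nm; case: (s n); lra.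
    * by have := natr_lt_succ R nm; case: (s n); lra.
  + by move/(linked_same_chart Bw By)=> e; rewrite e eqxx in mn.
Qed.

(** By [block_next] read in the chart, a component that is not such a core either has an immediate
    neighbour in its own copy or is the last of that copy. In the latter case its immediate
    neighbour is the facing end component of the adjacent copy. *)
Lemma one_sided_limit_spread (R : realType) c s e (x : R) :
  one_sided_limit e (spread R c s) x ->
  exists n, s n = e /\ linked (spread R c s) x (core_point R s n).
Proof.
move=> [[n Bx] [y [[m By] xy nxy]] xP].
have [|[_ nlast]|] := block_next (s n == e) Bx.
- move=> [/eqP se c0]; exists n; split => //.
  rewrite -(linked_chart Bx (block_core_point R c s n)) placeK.
  by apply: core_linked (core_mid _ _); exact: block_le0.
- have mn : m != n.
    apply: contra_notN nxy => /eqP mn; subst m.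
    by rewrite -(linked_chart Bx By); apply: nlast => //; rewrite -before_chart.
  have hx := chart_bounds Bx; have hy := chart_bounds By.
  have nm : if e then (n < m)%N else (m < n)%N.
    move: mn xy; rewrite /before; case: ltngtP => // h _;
      by have := natr_lt_succ R h; case: (e) => // *; exfalso; lra.
  (* [k] is the index of the adjacent copy in direction [e]; for decreasing [e] it exists because
     [m < n] makes [n] positive. *)
  have [k nk1] : exists k, if e then k = n.+1 else n = k.+1.
    case: (e) nm => [_|mn']; first by exists n.+1.
    by exists n.-1; rewrite (ltn_predK mn').
  have hk' : if e then k%:R = n%:R + 1 :> R else k%:R = n%:R - 1 :> R.
    by move: nk1; case: (e) => ->; rewrite -natr1//; lra.
  (* [v] marks the component of copy [k] that faces copy [n]: the direction opposite to [e] becomes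
     [s k != e] in the chart of [k]. *)
  have [v [Bv vP]] := block_last R c (s k != e).
  rewrite -(placeK s k v) in Bv; have hv := chart_bounds Bv.
  have nk : n != k by apply/eqP => nk; move: hk'; rewrite nk; case: (e); lra.
  have [|||w [[l Bw] xw wv nxw nwv]] := xP (place s k v).
  + by exists k.
  + by move: hk'; rewrite /before; case: (e); lra.
  + by move/(linked_same_chart Bx Bv) => E; rewrite E eqxx in nk.
  have hw := chart_bounds Bw.
  (* Anything between adjacent copies belongs to one of the two, and both cases contradict
     extremality there. *)
  have [ln|ln] : l = n \/ l = k.
    have ltF (i j : nat) : ~ (i%:R + 1 <= j%:R :> R) -> (j <= i)%N.
      by move=> h; rewrite leqNgt; apply/negP => /(natr_lt_succ R).
    move: nk1 xw wv hk'; rewrite /before; case: (e) => nk1 xw wv hk'.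
    - have nl : (n <= l)%N by apply: ltF => ?; lra.
      have lk : (l <= n.+1)%N by rewrite -nk1; apply: ltF => ?; lra.
      by move: nl lk; rewrite leq_eqVlt => /orP[/eqP->|];
        [left|right; apply/eqP; rewrite eqn_leq nk1 lk].
    - have kl : (k <= l)%N by apply: ltF => ?; lra.
      have ln : (l <= k.+1)%N by rewrite -nk1; apply: ltF => ?; lra.
      by move: kl ln; rewrite leq_eqVlt => /orP[/eqP->|];
        [right|left; apply/eqP; rewrite eqn_leq nk1 ln].
  + case: nxw; subst l; rewrite -(linked_chart Bx Bw); apply: nlast => //.
    by rewrite -before_chart.
  + case: nwv; subst l; rewrite -(linked_chart Bw Bv) (placeK s k v).
    apply: linked_sym; apply: vP => //; move: wv; rewrite (before_chart s k) placeK.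
    by case: eqP.
- move=> [v [Bv xv nxv vP]]; rewrite -(placeK s n v) in Bv nxv xv.
  rewrite -before_chart in xv; rewrite (linked_chart Bx Bv) in nxv.
  have hx := chart_bounds Bx; have hv := chart_bounds Bv.
  have [|w [Xw xw wv nxw nwv]] := xP _ _ xv nxv; first by exists n.
  have Bw : block R c (chart s n w).
    by apply: spread_chart Xw; move: xw wv; rewrite /before; case: (e); lra.
  rewrite (before_chart s n) in xw; rewrite (before_chart s n) placeK in wv.
  have [] := vP _ Bw xw wv.
  + by rewrite (linked_chart Bx Bw).
  + by rewrite -{1}(placeK s n v) (linked_chart Bw Bv).
Qed.

Lemma core_point_lt (R : realType) c s n m (x y : R) :
  linked (spread R c s) x (core_point R s n) ->
  linked (spread R c s) y (core_point R s m) -> (n < m)%N -> x < y.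
Proof.
move=> lx ly nm; have nm' := natr_lt_succ R nm.
have [k Bx] := linkedl lx; have [l By] := linkedl ly.
have ek := linked_same_chart Bx (block_core_point R c s n) lx.
have el := linked_same_chart By (block_core_point R c s m) ly.
by subst k l; have := chart_bounds Bx; have := chart_bounds By; lra.
Qed.

Lemma spread_core_point (R : realType) c s n : spread R c s (core_point R s n).
Proof. by exists n; exact: block_core_point. Qed.

Lemma core_point_linked_inj (R : realType) c s n m :
  linked (spread R c s) (core_point R s n) (core_point R s m) -> n = m.
Proof.
exact: linked_same_chart (block_core_point R c s n) (block_core_point R c s m).
Qed.

(** The image of a core is a one-sided limit in the same direction, hence linked to a core of the
    same orientation; monotonicity of [f] makes the index map strictly increasing. *)
Lemma oiso_core_points (R : realType) c s t (f g : R -> R) :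
  cut_balanced (spread R c s) -> cut_balanced (spread R c t) ->
  oiso f g (spread R c s) (spread R c t) ->
  exists h : nat -> nat, [/\ {homo h : n m / (n < m)%N},
    forall n, t (h n) = s n
    & forall n, linked (spread R c t) (f (core_point R s n)) (core_point R t (h n))].
Proof.
move=> cs ct o.
have hP n : exists m, t m = s n /\
    linked (spread R c t) (f (core_point R s n)) (core_point R t m).
  apply: one_sided_limit_spread.
  exact: (oiso_one_sided_limit cs ct o (one_sided_limit_core_point _ _ _ _)).
have [h /= hh] := choice hP.
have hl n := (hh n).2; exists h; split=> [n m nm|n|//]; last exact: (hh n).1.
have Xc k := spread_core_point R c s k.
have cc k : linked (spread R c s) (core_point R s k) (core_point R s k).
  by move=> z hz; have -> : z = core_point R s k by lra.
have fnm := oiso_lt o (Xc n) (Xc m) (core_point_lt (cc n) (cc m) nm).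
case: (ltngtP (h n) (h m)) => // [hmn|e].
- by have := core_point_lt (hl m) (hl n) hmn; lra.
- have : linked (spread R c t) (f (core_point R s n)) (f (core_point R s m)).
    by apply: linked_trans (hl n) _; rewrite e; exact: linked_sym.
  rewrite (oiso_linkedE cs ct o)// => /core_point_linked_inj E.
  by rewrite E ltnn in nm.
Qed.

Lemma homo_ltn_ge (h : nat -> nat) :
  {homo h : n m / (n < m)%N} -> forall n, (n <= h n)%N.
Proof. by move=> hM; elim=> // n /leq_ltn_trans; apply; exact: hM. Qed.

(** The index maps [h] and [k] of the isomorphism and its inverse satisfy [k (h n) = n]. Strictly
    increasing maps of the naturals never decrease a number, so [n <= h n <= k (h n) = n]. *)
Lemma spread_rigid (R : realType) c s t (f g : R -> R) :
  cut_balanced (spread R c s) -> cut_balanced (spread R c t) ->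
  oiso f g (spread R c s) (spread R c t) -> s = t.
Proof.
move=> cs ct o; have [h [hM ht hl]] := oiso_core_points cs ct o.
have [k [kM _ kl]] := oiso_core_points ct cs (oiso_sym o).
apply/funext => n; rewrite -ht.
suff -> : h n = n by [].
have khn : k (h n) = n.
  apply/esym/(@core_point_linked_inj R c s).
  apply: linked_trans (kl (h n)).
  have := oiso_linked cs (oiso_sym o) (hl n).
  by rewrite (oisoK o)//; exact: spread_core_point.
apply/eqP; rewrite eqn_leq homo_ltn_ge// andbT.
by rewrite -{2}khn homo_ltn_ge.
Qed.

(** * Metric similarity by turning blocks *)

Definition chart_index (R : realType) c s (x : R) : nat :=
  xget 0%N [set n | block R c (chart s n x)].

Lemma chart_indexE (R : realType) c s n (x : R) :
  block R c (chart s n x) -> chart_index c s x = n.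
Proof.
move=> Bx; apply: xget_unique => // m; apply: chart_uniq.
have := chart_bounds Bx; lra.
Qed.

Definition turn (R : realType) c s t (x : R) : R :=
  place t (chart_index c s x) (chart s (chart_index c s x) x).

Lemma turnE (R : realType) c s t n (x : R) :
  block R c (chart s n x) -> turn c s t x = place t n (chart s n x).
Proof. by move=> Bx; rewrite /turn (chart_indexE Bx). Qed.

Lemma turn_block (R : realType) c s t n (x : R) :
  block R c (chart s n x) -> block R c (chart t n (turn c s t x)).
Proof. by move=> Bx; rewrite (turnE t Bx) placeK. Qed.

Lemma turn_spread (R : realType) c s t (x : R) :
  spread R c s x -> spread R c t (turn c s t x).
Proof. by move=> [n Bx]; exists n; exact: turn_block. Qed.

Lemma turnK (R : realType) c s t (x : R) :
  spread R c s x -> turn c t s (turn c s t x) = x.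
Proof.
move=> [n Bx]; rewrite (turnE s (turn_block t Bx)) (turnE t Bx).
by rewrite placeK chartK.
Qed.

(** Points at distance below 1 share a copy, and on a single copy [turn] is a translation or a
    reflection. *)
Lemma turn_dist (R : realType) c s t (x y : R) :
  spread R c s x -> spread R c s y -> `|x - y| < 1 ->
  `|turn c s t x - turn c s t y| = `|x - y|.
Proof.
move=> [n Bx] Yy xy.
have By : block R c (chart s n y).
  apply: spread_chart Yy; have := chart_bounds Bx.
  by move: xy; rewrite ltr_norml; lra.
rewrite (turnE t Bx) (turnE t By) /place /chart.
case: (t n); case: (s n); [|rewrite [RHS]distrC|rewrite [RHS]distrC|];
  by congr (`|_|); lra.
Qed.

Definition turn_map (R : realType) c s t (x : spread R c s) : spread R c t :=
  SigSub (mem_set (turn_spread t (set_valP x))).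

Lemma turn_mapK (R : realType) c s t :
  cancel (@turn_map R c s t) (@turn_map R c t s).
Proof. by move=> x; apply: val_inj; exact: turnK (set_valP x). Qed.

Lemma turn_map_unif_continuous (R : realType) c s t :
  unif_continuous (@turn_map R c s t).
Proof.
apply/unif_continuousP => e e0; exists (Num.min 1 e).
  by rewrite lt_min e0 ltr01.
move=> [x y] /= xy.
have {xy} : `|val x - val y| < Num.min 1 e := xy.
rewrite lt_min => /andP[xy1 xye].
suff : `|val (turn_map t x) - val (turn_map t y)| < e by [].
by rewrite (turn_dist t (set_valP x) (set_valP y)).
Qed.

Lemma unif_continuous_continuous (U V : uniformType) (f : U -> V) :
  unif_continuous f -> continuous f.
Proof.
move=> uf x; apply/cvg_app_entourageP => A /uf /= eA.
apply: filterS (nbhs_entourage x eA) => y /xsectionP //.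
Qed.

Lemma spread_similar (R : realType) c s t :
  metrically_similar (spread R c s) (spread R c t).
Proof.
exists (@turn_map R c s t), (@turn_map R c t s).
by split; [exact: turn_mapK|exact: turn_mapK| |]; exact: turn_map_unif_continuous.
Qed.

Lemma metrically_similar_homeomorphic (R : realType) (X Y : set R) :
  metrically_similar X Y -> homeomorphic X Y.
Proof.
move=> [f [g [fK gK uf ug]]]; exists f, g.
by split => //; exact: unif_continuous_continuous.
Qed.

(** * Openness and closedness of the constructed sets *)

Lemma open_of_dist (R : realType) (X : set R) :
  (forall x, X x -> exists2 d, 0 < d & forall y, `|x - y| < d -> X y) -> open X.
Proof.
move=> h; rewrite openE => x /h[d d0 dX]; apply/nbhs_ballP.
by exists d => // y; exact: dX.
Qed.

Lemma closed_of_dist (R : realType) (X : set R) :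
  (forall x, (forall d, 0 < d -> exists2 y, X y & `|x - y| < d) -> X x) ->
  closed X.
Proof.
move=> h x clx; apply: h => d d0.
by have [y [Xy xy]] := clx _ (nbhsx_ballx x d d0); exists y.
Qed.

Lemma chart_dist (R : realType) s n (x y : R) :
  `|chart s n x - chart s n y| = `|x - y|.
Proof.
by rewrite /chart; case: (s n); [|rewrite [RHS]distrC]; congr (`|_|); lra.
Qed.

Lemma open_spread (R : realType) s : open (spread R false s).
Proof.
apply: open_of_dist => x [n Bx].
suff [d d0 dB] : exists2 d, 0 < d &
    forall u, `|chart s n x - u| < d -> block R false u.
  by exists d => // y xy; exists n; apply: dB; rewrite chart_dist.
move: (chart s n x) Bx => u [/andP[/= h1 h2]|[k _ /andP[/= h1 h2]]].
- exists (Num.min (u + 1) (- u)); first by rewrite lt_min; lra.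
  by move=> v; rewrite lt_min !ltr_norml => hv; left; apply/andP; rewrite /=; lra.
- exists (Num.min (u - scale R k) (2 * scale R k - u)).
    by rewrite lt_min; lra.
  move=> v; rewrite lt_min !ltr_norml => hv; right; exists k => //.
  by apply/andP; rewrite /=; lra.
Qed.

Lemma scale_small (R : realType) (e : R) : 0 < e -> exists k, scale R k < e.
Proof.
move=> e0; exists (Num.bound e^-1).
have h : e^-1 < (Num.bound e^-1)%:R by rewrite archi_boundP// invr_ge0 ltW.
set N := Num.bound _ in h *.
have h4 : e^-1 < 4 ^+ N.
  by apply: (lt_trans h); rewrite -natrX ltr_nat ltn_expl.
by rewrite /scale exprVn -[ltRHS]invrK ltf_pV2// ?posrE ?exprn_gt0// invr_gt0.
Qed.

Lemma closed_block (R : realType) : closed (block R true).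
Proof.
apply: closed_of_dist => z hz.
have z1 : -1 <= z.
  rewrite leNgt; apply/negP => h.
  have [|y /block_bounds hy] := hz (-1 - z); first lra.
  by rewrite ltr_norml; lra.
have z2 : z <= 2.
  rewrite leNgt; apply/negP => h.
  have [|y /block_bounds hy] := hz (z - 2); first lra.
  by rewrite ltr_norml; lra.
have [z0|z0] := leP z 0; first by left; apply/andP; rewrite /=; lra.
(* The least such [k] gives [scale R k / 2 < z <= 2 * scale R k], so [z] is in brick [k] or in the
   gap below it. The gap is excluded because a small ball around [z] would stay inside it. *)
have exk : exists k, scale R k < 2 * z by apply: scale_small; lra.
case: (ex_minnP exk) => k kz kmin; right; exists k => //; apply/andP; rewrite /=.
split; last first.
  case: k kz kmin => [|k] kz kmin; first by rewrite /scale expr0; lra.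
  have : ~~ (scale R k < 2 * z) by apply/negP => /kmin; rewrite ltnn.
  by rewrite scaleS; lra.
rewrite leNgt; apply/negP => zk.
have [|y By] := hz (Num.min (scale R k - z) (z - scale R k / 2)).
  by rewrite lt_min; lra.
rewrite lt_min !ltr_norml => hy; apply: (@block_gap R true k y _ By).
lra.
Qed.

Lemma closed_spread (R : realType) s : closed (spread R true s).
Proof.
apply: closed_of_dist => z hz.
(* Radius 1 puts [z] within 3 of the centre of copy [n]; points within 1 of [z] are then within 4,
   where only copy [n] is present. *)
have [y0 [n /chart_bounds By0]] := hz 1 ltr01.
rewrite ltr_norml => zy0; exists n; apply: closed_block => A.
move=> /nbhs_ballP[d /= d0 dA].
have [|y Xy] := hz (Num.min d 1); first by rewrite lt_min d0 ltr01.
rewrite lt_min => /andP[zyd zy1]; exists (chart s n y); split.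
  by apply: spread_chart Xy; move: zy1; rewrite ltr_norml; lra.
by apply: dA; rewrite /ball /= chart_dist.
Qed.

(** * Decomposition into nondegenerate closed intervals *)

Lemma linked_component (R : realType) (X : set R) x y :
  linked X x y -> connected_component X x y.
Proof.
move=> l; pose B := [set z | (x <= z <= y) || (y <= z <= x)].
apply: (@connected_component_max _ _ B) => //; rewrite /B /=; try lra.
apply/connected_intervalP => u v /= hu hv w hw; lra.
Qed.

(** The family is that of the connected components, which are closed because [X] is, and
    nondegenerate because each point is linked to another one. *)
Lemma closed_interval_unions_linked (R : realType) (X : set R) : closed X ->
  (forall x, X x -> exists2 y, y != x & linked X x y) ->
  closed_interval_unions X.
Proof.
move=> cX Xlink; split => //.
exists [set connected_component X x | x in X]; split.
- move=> _ [x Xx <-]; split.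
  + exact/connected_intervalP/component_connected.
  + exact: component_closed.
  + have [y yx /linked_component Cy] := Xlink _ Xx.
    have Cx := connected_component_refl Xx.
    case: (ltgtP y x) yx => // h _; [by exists y, x|by exists x, y].
- move=> _ _ [x Xx <-] [y Xy <-] [z [/= xz yz]].
  by rewrite (same_connected_component xz) (same_connected_component yz).
- by rewrite connected_component_cover.
Qed.

Lemma closed_interval_unions_spread (R : realType) s :
  closed_interval_unions (spread R true s).
Proof.
apply: closed_interval_unions_linked; first exact: closed_spread.
move=> x [n Bx].
suff [v vu l] : exists2 v, v != chart s n x & linked (block R true) (chart s n x) v.
  exists (place s n v); first by apply: contra_neq vu => <-; rewrite placeK.
  rewrite -(placeK s n v) in l; have Bv := linkedl (linked_sym l).
  exact/(linked_chart Bx Bv).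
(* Closed cores and bricks contain both endpoints, and at least one endpoint differs from the given
   point. *)
case: (Bx) => [Cx|[k _ hk]].
- have hx := core_le Cx.
  have [h|h] : chart s n x < 0 \/ -1 < chart s n x by lra.
  + exists 0; first lra.
    by apply: core_linked => //; apply/andP; rewrite /=; lra.
  + exists (-1); first lra.
    by apply: core_linked => //; apply/andP; rewrite /=; lra.
- have k0 := scale_gt0 R k; have hx := brick_le hk.
  have [h|h] : chart s n x < 2 * scale R k \/ scale R k < chart s n x by lra.
  + exists (2 * scale R k); first lra.
    by apply: brick_linked hk _; apply/andP; rewrite /=; lra.
  + exists (scale R k); first lra.
    by apply: brick_linked hk _; apply/andP; rewrite /=; lra.
Qed.

(** * A family indexed by the reals *)

(** The cut is read through the encoding of rationals by naturals; a natural encoding no rational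
    gets the value [false]. *)
Definition rat_cut (R : realType) (r : R) (n : nat) : bool :=
  if unpickle n is Some q then ratr (q : rat) < r else false.

Lemma rat_cut_inj (R : realType) : injective (@rat_cut R).
Proof.
have lt_neq (r r' : R) : r < r' -> rat_cut r <> rat_cut r'.
  move=> /rat_in_itvoo[q]; rewrite in_itv /= => /andP[rq qr'] e.
  by have := congr1 (fun h => h (pickle q)) e; rewrite /rat_cut pickleK qr' lt_gtF.
by move=> r r' e; case: (ltgtP r r') => // /lt_neq; rewrite e.
Qed.

Lemma spread_family (R : realType) c (A : set (set R)) :
  (forall s, A (spread R c s)) -> (forall s, cut_balanced (spread R c s)) ->
  exists F : set (set R),
    [/\ F `<=` A, F #= [set: R]
      & forall X Y : set R, F X -> F Y -> X <> Y ->
          [/\ metrically_similar X Y, homeomorphic X Y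
            & ~ order_isomorphic X Y]].
Proof.
move=> AS cb.
have rigid s t : order_isomorphic (spread R c s) (spread R c t) -> s = t.
  by move=> /order_isomorphic_oiso[f [g]]; exact: spread_rigid.
exists [set spread R c (rat_cut r) | r in [set: R]]; split.
- by move=> _ [r _ <-].
(* Equal sets are order-isomorphic through the identity, so rigidity also yields the injectivity
   that gives the family the cardinality of the reals. *)
- apply: inj_card_eq => r r' _ _ e; apply/rat_cut_inj/rigid; rewrite e.
  by exists id; split => //; rewrite image_id.
- move=> _ _ [r _ <-] [r' _ <-] ne; split.
  + exact: spread_similar.
  + exact/metrically_similar_homeomorphic/spread_similar.
  + by move=> /rigid e; apply: ne; rewrite e.
Qed.

Theorem proposition2 (R : realType) :
  (exists F : set (set R),
     [/\ F `<=` @open_sets R,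
         F #= [set: R]
       & forall X Y : set R, F X -> F Y -> X <> Y ->
           [/\ metrically_similar X Y, homeomorphic X Y
             & ~ order_isomorphic X Y]]) /\
  (exists F : set (set R),
     [/\ F `<=` @closed_interval_unions R,
         F #= [set: R]
       & forall X Y : set R, F X -> F Y -> X <> Y ->
           [/\ metrically_similar X Y, homeomorphic X Y
             & ~ order_isomorphic X Y]]).
Proof.
split.
- apply: (@spread_family R false) => s; first exact: open_spread.
  exact/open_cut_balanced/open_spread.
- apply: (@spread_family R true) => s; first exact: closed_interval_unions_spread.
  exact/closed_cut_balanced/closed_spread.
Qed.
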